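(* Let $p$ be a prime and let $T:\mathbb{Z}_p\to\mathbb{Z}_p$ be in the Mahler-Bernoulli class, with associated constant $C=p^k$ (where $k\geq 1$). Then $T$ is $(p^{-k},p^k)$ locally scaling, and $T$ is topologically isomorphic to $\mathcal{S}^k$.
   Context: $|\cdot|$ denotes the $p$-adic absolute value on $\mathbb{Z}_p$, normalized so that $|p|=1/p$. Mahler-Bernoulli class: let $T:\mathbb{Z}_p\to\mathbb{Z}_p$ be given by the uniformly converging Mahler series $T(x)=\sum_{n=0}^\infty A_n\binom{x}{n}$, where $A_n\in\mathbb{Z}_p$, and set $C=\max_{n\geq 1} p^{\lfloor \log_p n\rfloor}|A_n|$. $T$ is in the Mahler-Bernoulli class if: (1) there is a unique $n_0\geq 1$ attaining this maximum; (2) $n_0=p^k$ for some integer $k>0$; (3) $|A_{n_0}|=1$ (thus $C=n_0=p^k$). Locally scaling: for $r=p^\ell$ with $\ell\le 0$ an integer and $C=p^m$ with $m\geq 0$ an integer, a map $T:\mathbb{Z}_p\to\mathbb{Z}_p$ is $(r,C)$ locally scaling if $|T(x)-T(y)|=C|x-y|$ for all $x,y\in\mathbb{Z}_p$ with $|x-y|\leq r$. Topologically isomorphic: maps $T,S:\mathbb{Z}_p\to\mathbb{Z}_p$ are topologically isomorphic if there is a homeomorphism $\Phi:\mathbb{Z}_p\to\mathbb{Z}_p$ with $\Phi\circ T=S\circ\Phi$. The $p$-adic shift $\mathcal{S}:\mathbb{Z}_p\to\mathbb{Z}_p$: if $x=\sum_{i\geq 0} b_i p^i$ with $b_i\in\{0,1,\dots,p-1\}$,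 then $\mathcal{S}(x)=\sum_{i\geq 0} b_{i+1}p^i$. $\mathcal{S}^k$ is its $k$-fold iterate. *)

(* Defs.v *)
From HB Require Import structures.
From mathcomp Require Import all_boot all_order all_algebra.
From mathcomp Require Import all_classical all_reals all_analysis.
From mathcomp Require Import zify.

Set Implicit Arguments.
Unset Strict Implicit.
Unset Printing Implicit Defensive.

Import Order.TTheory GRing.Theory Num.Theory.

Local Open Scope ring_scope.
Local Open Scope classical_set_scope.

(* [padic_int pr] is Z_p as the inverse limit of the rings Z/p^n: [residue x n]
   is the representative in {0, ..., p^n - 1} of x mod p^n. *)
Record padic_int (p : nat) (pr : prime p) := PadicInt {
  residue : nat -> nat;
  residue_coh : forall n, (residue n.+1 %% p ^ n)%N = residue n }.

HB.instance Definition _ p (pr : prime p) := gen_eqMixin (padic_int pr).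
HB.instance Definition _ p (pr : prime p) := gen_choiceMixin (padic_int pr).

Section PadicRing.
Variables (p : nat) (pr : prime p).
Local Notation Zp := (padic_int pr).

Lemma residue_inj : injective (@residue p pr).
Proof.
move=> [f hf] [g hg] /= fg; rewrite -fg in hg *.
by congr PadicInt; exact: Prop_irrelevance.
Qed.

Lemma padic_eqP (x y : Zp) : (forall n, residue x n = residue y n) -> x = y.
Proof. by move=> xy; apply: residue_inj; apply/funext. Qed.

Lemma pX_gt0 n : (0 < p ^ n)%N.
Proof. by rewrite expn_gt0 prime_gt0. Qed.

Lemma residue_mod (x : Zp) m n : (m <= n)%N ->
  (residue x n %% p ^ m)%N = residue x m.
Proof.
elim: n => [|n IHn].
  by rewrite leqn0 => /eqP ->; rewrite -(residue_coh x 0) modn_mod.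
rewrite leq_eqVlt => /predU1P[->|].
  by rewrite -(residue_coh x n.+1) modn_mod.
rewrite ltnS => mn; rewrite -(IHn mn) -(residue_coh x n).
by rewrite modn_dvdm// dvdn_exp2l.
Qed.

Lemma residue_small (x : Zp) n : (residue x n %% p ^ n)%N = residue x n.
Proof. exact: residue_mod. Qed.

Lemma residue_lt (x : Zp) n : (residue x n < p ^ n)%N.
Proof. by rewrite -residue_small ltn_mod pX_gt0. Qed.

Lemma residue0n (x : Zp) : residue x 0 = 0%N.
Proof. by have := residue_lt x 0; rewrite expn0; case: (residue x 0). Qed.

Fact padic_of_key (f : nat -> nat) (hf : forall n, f n.+1 = f n %[mod p ^ n]) n :
  ((f n.+1 %% p ^ n.+1) %% p ^ n)%N = (f n %% p ^ n)%N.
Proof. by rewrite modn_dvdm ?hf// dvdn_exp2l. Qed.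

(* The p-adic integer congruent to [f n] modulo p^n for all n. *)
Definition padic_of f (hf : forall n, f n.+1 = f n %[mod p ^ n]) : Zp :=
  PadicInt pr (padic_of_key hf).

Lemma nat_coh (m n : nat) : m = m %[mod p ^ n]. Proof. by []. Qed.

Lemma add_coh (x y : Zp) n :
  (residue x n.+1 + residue y n.+1)%N = (residue x n + residue y n)%N
    %[mod p ^ n].
Proof. by rewrite -(residue_coh x n) -(residue_coh y n) modnDm. Qed.

Lemma mul_coh (x y : Zp) n :
  (residue x n.+1 * residue y n.+1)%N = (residue x n * residue y n)%N
    %[mod p ^ n].
Proof. by rewrite -(residue_coh x n) -(residue_coh y n) modnMm. Qed.

Lemma opp_coh (x : Zp) n :
  (p ^ n.+1 - residue x n.+1)%N = (p ^ n - residue x n)%N %[mod p ^ n].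
Proof.
have le1 := ltnW (residue_lt x n.+1); have le0 := ltnW (residue_lt x n).
apply/eqP; rewrite -(eqn_modDr (residue x n.+1)) subnK//.
rewrite -(modnDmr _ (residue x n.+1)) residue_coh subnK// modnn.
by rewrite expnS modnMl.
Qed.

Definition padic_add x y : Zp := padic_of (add_coh x y).
Definition padic_mul x y : Zp := padic_of (mul_coh x y).
Definition padic_opp x : Zp := padic_of (opp_coh x).

Lemma padic_addA : associative padic_add.
Proof.
by move=> x y z; apply: padic_eqP => n /=; rewrite modnDml modnDmr addnA.
Qed.

Lemma padic_addC : commutative padic_add.
Proof. by move=> x y; apply: padic_eqP => n /=; rewrite addnC. Qed.

Lemma padic_add0 : left_id (padic_of (nat_coh 0)) padic_add.
Proof.
by move=> x; apply: padic_eqP => n /=; rewrite mod0n add0n residue_small.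
Qed.

Lemma padic_addN : left_inverse (padic_of (nat_coh 0)) padic_opp padic_add.
Proof.
move=> x; apply: padic_eqP => n /=.
by rewrite modnDml subnK ?modnn ?mod0n// ltnW ?residue_lt.
Qed.

HB.instance Definition _ :=
  GRing.isZmodule.Build Zp padic_addA padic_addC padic_add0 padic_addN.

Lemma padic_mulA : associative padic_mul.
Proof.
by move=> x y z; apply: padic_eqP => n /=; rewrite modnMml modnMmr mulnA.
Qed.

Lemma padic_mulC : commutative padic_mul.
Proof. by move=> x y; apply: padic_eqP => n /=; rewrite mulnC. Qed.

Lemma padic_mul1 : left_id (padic_of (nat_coh 1)) padic_mul.
Proof.
by move=> x; apply: padic_eqP => n /=; rewrite modnMml mul1n residue_small.
Qed.

Lemma padic_mulD : left_distributive padic_mul padic_add.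
Proof.
by move=> x y z; apply: padic_eqP => n /=; rewrite modnMml modnDm mulnDl.
Qed.

Lemma padic_1neq0 : padic_of (nat_coh 1) != 0 :> Zp.
Proof.
apply/eqP => /(congr1 (fun x : Zp => residue x 1)) /=.
by rewrite mod0n modn_small// expn1 prime_gt1.
Qed.

HB.instance Definition _ :=
  GRing.Zmodule_isComNzRing.Build Zp
    padic_mulA padic_mulC padic_mul1 padic_mulD padic_1neq0.

Lemma residue0 n : residue (0 : Zp) n = 0%N.
Proof. exact: mod0n. Qed.

Lemma residueD (x y : Zp) n :
  residue (x + y) n = ((residue x n + residue y n) %% p ^ n)%N.
Proof. by []. Qed.

Lemma residueN (x : Zp) n :
  residue (- x) n = ((p ^ n - residue x n) %% p ^ n)%N.
Proof. by []. Qed.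

Lemma residueM (x y : Zp) n :
  residue (x * y) n = ((residue x n * residue y n) %% p ^ n)%N.
Proof. by []. Qed.

Lemma residue_nat m n : residue (m%:R : Zp) n = (m %% p ^ n)%N.
Proof.
elim: m => [|m IHm]; first by rewrite residue0 mod0n.
by rewrite -natr1 residueD IHm /= modnDm addn1.
Qed.

Lemma residueB_eq0 (x y : Zp) n :
  (residue (x - y) n == 0%N) = (residue x n == residue y n).
Proof.
rewrite residueD residueN modnDmr.
rewrite -[in RHS](residue_small x) -[in RHS](residue_small y).
rewrite -(eqn_modDr (p ^ n - residue y n)) subnKC ?modnn//.
by rewrite ltnW ?residue_lt.
Qed.

End PadicRing.

Section PadicAbs.
Variables (p : nat) (pr : prime p).
Local Notation Zp := (padic_int pr).

(* For x != 0, the least n with x not in p^n Z_p is v_p(x) + 1. *)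
Definition padic_abs (x : Zp) : rat :=
  match pselect (exists n, residue x n != 0%N) with
  | left nz => p%:R ^- (ex_minn nz).-1
  | right _ => 0
  end.

Lemma p_gt1 : 1 < p%:R :> rat.
Proof. by rewrite ltr1n prime_gt1. Qed.

Lemma pV_gt0 n : 0 < p%:R ^- n :> rat.
Proof. by rewrite invr_gt0 exprn_gt0// ltr0n prime_gt0. Qed.

Lemma residue_eq0_le (x : Zp) m n :
  (m <= n)%N -> residue x n = 0%N -> residue x m = 0%N.
Proof. by move=> mn xn; rewrite -(residue_mod x mn) xn mod0n. Qed.

Lemma padic_abs_le (x : Zp) n : (padic_abs x <= p%:R ^- n) = (residue x n == 0%N).
Proof.
rewrite /padic_abs; case: pselect => [nz|z]; last first.
  rewrite ltW ?pV_gt0//; apply/esym/negPn/negP => xn.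
  by apply: z; exists n.
case: ex_minnP => m xm mmin; have m0 : (0 < m)%N.
  by case: m xm {mmin} => //; rewrite residue0n.
rewrite lef_pV2 ?posrE ?exprn_gt0 ?ltr0n ?prime_gt0//.
rewrite ler_eXn2l ?p_gt1//; apply/idP/idP => [nm|/eqP xn].
  apply/negPn/negP => /mmin; lia.
rewrite -ltnS prednK// ltnNge; apply/negP => mn.
by move: xm; rewrite (residue_eq0_le mn xn).
Qed.

Lemma padic_abs_ge0 (x : Zp) : 0 <= padic_abs x.
Proof. by rewrite /padic_abs; case: pselect => // ?; rewrite ltW ?pV_gt0. Qed.

Lemma padic_abs_val (x : Zp) :
  x = 0 \/ exists n, padic_abs x = p%:R ^- n.
Proof.
rewrite /padic_abs; case: pselect => [nz|z]; first by right; eexists.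
left; apply: padic_eqP => n; rewrite residue0; apply/eqP/negPn/negP => xn.
by apply: z; exists n.
Qed.

Lemma padic_abs0 : padic_abs 0 = 0.
Proof.
by rewrite /padic_abs; case: pselect => // nz; have [n] := nz; rewrite residue0 eqxx.
Qed.

Lemma padic_abs_eq0 (x : Zp) : padic_abs x = 0 -> x = 0.
Proof.
move=> x0; apply: padic_eqP => n; rewrite residue0; apply/eqP.
by rewrite -padic_abs_le x0 ltW ?pV_gt0.
Qed.

Lemma padic_absN (x : Zp) : padic_abs (- x) = padic_abs x.
Proof.
wlog suff: x / padic_abs (- x) <= padic_abs x.
  by move=> H; apply/le_anti; rewrite H -{1}[x]opprK H.
have [->|[n xn]] := padic_abs_val x; first by rewrite oppr0.
by rewrite xn padic_abs_le -sub0r residueB_eq0 residue0 eq_sym -padic_abs_le xn.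
Qed.

Lemma padic_abs_ultra (x y : Zp) :
  padic_abs (x + y) <= Num.max (padic_abs x) (padic_abs y).
Proof.
wlog xy : x y / padic_abs x <= padic_abs y => [H|].
  have /orP[xy|yx] := le_total (padic_abs x) (padic_abs y); first exact: H.
  by rewrite addrC maxC; exact: H.
rewrite (max_idPr xy); have [y0|[n yn]] := padic_abs_val y.
  by rewrite y0 addr0 -y0.
rewrite yn padic_abs_le residueD; move: xy; rewrite yn padic_abs_le => /eqP ->.
move/eqP: yn; rewrite eq_le padic_abs_le => /andP[/eqP -> _].
by rewrite mod0n.
Qed.

Definition padic_dist (x y : Zp) : rat := padic_abs (x - y).

Fact padic_distxx x : padic_dist x x = 0.
Proof. by rewrite /padic_dist subrr padic_abs0. Qed.

Fact padic_dist_eq0 x y : padic_dist x y = 0 -> x = y.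
Proof. by move/padic_abs_eq0/subr0_eq. Qed.

Fact padic_dist_sym x y : padic_dist x y = padic_dist y x.
Proof. by rewrite /padic_dist -padic_absN opprB. Qed.

Fact padic_dist_triangle y x z :
  padic_dist x z <= padic_dist x y + padic_dist y z.
Proof.
rewrite /padic_dist -(subrKA y); apply: le_trans (padic_abs_ultra _ _) _.
by rewrite ge_max lerDl lerDr !padic_abs_ge0.
Qed.

HB.instance Definition _ := isMetric.Build rat Zp
  padic_distxx padic_dist_eq0 padic_dist_sym padic_dist_triangle.

End PadicAbs.

Section Dynamics.
Variables (p : nat) (pr : prime p).
Local Notation Zp := (padic_int pr).

(* x (x - 1) ... (x - n + 1) / n!; see [padic_binP] for existence and
   [padic_bin_uniq] for uniqueness of the quotient in Z_p. *)
Definition padic_bin (x : Zp) (n : nat) : Zp :=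
  xget 0 [set y | n`!%:R * y = \prod_(i < n) (x - i%:R)].

Definition mahler_series (A : nat -> Zp) (T : Zp -> Zp) :=
  {uniform, (fun N x => \sum_(n < N) A n * padic_bin x n) @ \oo --> T}.

Definition mahler_weight (A : nat -> Zp) (n : nat) : rat :=
  p%:R ^+ trunc_log p n * padic_abs (A n).

(* [C] is the constant max_(n >= 1) p^(floor (log_p n)) |A_n| of the series. *)
Definition mahler_bernoulli (T : Zp -> Zp) (C : rat) :=
  exists A : nat -> Zp, [/\ mahler_series A T,
    forall n, (1 <= n)%N -> mahler_weight A n <= C &
    exists n0 : nat, [/\ (1 <= n0)%N,
      mahler_weight A n0 = C,
      forall n, (1 <= n)%N -> mahler_weight A n = C -> n = n0,
      exists2 k : nat, (0 < k)%N & n0 = (p ^ k)%N &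
      padic_abs (A n0) = 1]].

Definition locally_scaling (r C : rat) (T : Zp -> Zp) :=
  [/\ exists2 l : int, l <= 0 & r = p%:R ^ l,
      exists m : nat, C = p%:R ^+ m &
      forall x y : Zp, padic_abs (x - y) <= r ->
        padic_abs (T x - T y) = C * padic_abs (x - y)].

Definition topologically_isomorphic (T S : Zp -> Zp) :=
  exists Phi Psi : Zp -> Zp,
    [/\ cancel Phi Psi, cancel Psi Phi, continuous Phi, continuous Psi &
        Phi \o T =1 S \o Phi].

Definition digit (x : Zp) (i : nat) : nat := (residue x i.+1 %/ p ^ i)%N.

Fact of_digits_key (b : nat -> nat) n :
  (\sum_(i < n.+1) b i * p ^ i)%N = (\sum_(i < n) b i * p ^ i)%N %[mod p ^ n].
Proof. by rewrite big_ord_recr /= addnC modnMDl. Qed.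

(* The sum of the series \sum_i b_i p^i; see [of_digits_cvg]. *)
Definition of_digits (b : nat -> nat) : Zp :=
  padic_of pr (of_digits_key b).

Definition padic_shift (x : Zp) : Zp := of_digits (fun i => digit x i.+1).

Lemma digit_lt x i : (digit x i < p)%N.
Proof. by rewrite ltn_divLR ?pX_gt0// -expnS residue_lt. Qed.

Lemma digitsK x : of_digits (digit x) = x.
Proof.
apply: padic_eqP => n /=; rewrite -[RHS]residue_small; congr (_ %% _)%N.
elim: n => [|n IHn]; first by rewrite big_ord0 residue0n.
rewrite big_ord_recr /= IHn /digit -(residue_coh x n).
by rewrite addnC -divn_eq.
Qed.

Lemma of_digits_cvg (b : nat -> nat) :
  (fun n => \sum_(i < n) (b i)%:R * p%:R ^+ i : Zp) @ \oo --> of_digits b.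
Proof.
apply/cvg_ballP => e e0; have [N Ne] : exists N, p%:R ^- N < e.
  exists (Num.truncn e^-1).+1; rewrite -ltf_pV2 ?posrE// ?pV_gt0// invrK.
  apply: lt_trans (truncnS_gt _) _; rewrite -natrX ltr_nat.
  by rewrite ltn_expl// prime_gt1.
near=> n; rewrite ballEmdist/=; apply: le_lt_trans Ne.
rewrite [mdist _ _]/(padic_abs _) padic_abs_le residueB_eq0.
have Nn : (N <= n)%N by near: n; exists N.
rewrite -(residue_mod (of_digits b) Nn) -(residue_mod (\sum_(i < n) _) Nn).
apply/eqP; congr (_ %% _)%N.
rewrite (_ : \sum_(i < n) _ = (\sum_(i < n) b i * p ^ i)%:R) ?residue_nat//.
by rewrite natr_sum; apply: eq_bigr => i _; rewrite natrM natrX.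
Unshelve. all: by end_near. Qed.

Lemma modn_cancel (m n u w : nat) : (0 < m)%N ->
  (m * u = m * w %[mod p ^ (logn p m + n)] -> u = w %[mod p ^ n])%N.
Proof.
wlog uw : u w / (w <= u)%N => [H m0 muw|m0].
  by case: (leqP w u) => [|/ltnW] uw; [exact: H|apply/esym/H].
move=> /eqP; rewrite eqn_mod_dvd ?leq_mul// -mulnBr => d.
apply/eqP; rewrite eqn_mod_dvd//; have [q cpq mE] := pfactor_coprime pr m0.
rewrite -(@Gauss_dvdr _ q) ?coprimeXl//.
rewrite -(@dvdn_pmul2l (p ^ logn p m)) ?pX_gt0// -expnD.
by rewrite mulnA (mulnC _ q) -mE.
Qed.

Lemma padic_natM_inj (m : nat) : (0 < m)%N -> injective (fun x : Zp => m%:R * x).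
Proof.
move=> m0 x y mxy; apply: padic_eqP => n.
have := congr1 (fun x : Zp => residue x (logn p m + n)) mxy.
rewrite !residueM residue_nat !modnMml => /(modn_cancel m0).
by rewrite !residue_mod ?leq_addl.
Qed.

Lemma padic_ffactE (a k : nat) :
  \prod_(i < k) (a%:R - i%:R : Zp) = (a ^_ k)%:R.
Proof.
elim: k => [|k IHk]; first by rewrite big_ord0.
rewrite big_ord_recr /= IHk ffactnSr.
have [ak|ka] := ltnP a k; first by rewrite ffact_small// mul0r mul0n.
by rewrite natrM natrB.
Qed.

Lemma residue_ffact (x : Zp) (k n : nat) :
  residue (\prod_(i < k) (x - i%:R)) n = (residue x n ^_ k %% p ^ n)%N.
Proof.
rewrite -(@residue_nat p pr) -padic_ffactE.
elim: k => [|k IHk]; first by rewrite !big_ord0.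
by rewrite !big_ord_recr !residueM IHk !residueD residue_nat residue_small.
Qed.

Fact bin_coh (x : Zp) (k n : nat) :
  'C(residue x (logn p k`! + n.+1), k) = 'C(residue x (logn p k`! + n), k)
    %[mod p ^ n].
Proof.
apply: (@modn_cancel k`!); first exact: fact_gt0.
rewrite ![(k`! * _)%N]mulnC !bin_ffact addnS.
rewrite -(residue_ffact x k (logn p k`! + n)) -(residue_coh (\prod_(i < k) _)).
by rewrite residue_ffact modn_dvdm// dvdn_exp2l.
Qed.

Lemma padic_bin_exists (x : Zp) (k : nat) :
  k`!%:R * padic_of pr (bin_coh x k) = \prod_(i < k) (x - i%:R).
Proof.
apply: padic_eqP => n; rewrite residueM residue_nat /= modnMm mulnC bin_ffact.
rewrite -(residue_mod _ (leq_addl (logn p k`!) n)) residue_ffact.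
by rewrite modn_dvdm// dvdn_exp2l// leq_addl.
Qed.

Lemma padic_binP (x : Zp) (k : nat) :
  k`!%:R * padic_bin x k = \prod_(i < k) (x - i%:R).
Proof.
by rewrite /padic_bin; case: xgetP => // /(_ _ (padic_bin_exists x k)).
Qed.

Lemma padic_bin_uniq (x y : Zp) (k : nat) :
  k`!%:R * y = \prod_(i < k) (x - i%:R) -> y = padic_bin x k.
Proof. by rewrite -padic_binP => /padic_natM_inj; apply; exact: fact_gt0. Qed.

End Dynamics.

(* Main.v *)
Require Import Defs.
From mathcomp Require Import all_boot all_order all_algebra.
From mathcomp Require Import all_classical all_reals all_analysis.

(** Two facts are combined, with h = x - y and |h| <= p^-k in the first.

    _Scaling_.  By the Vandermonde identity binom(y+h,n) - binom(y,n) is the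
    sum over 0 < j <= n of binom(h,j) binom(y,n-j), and the absorption identity
    j binom(h,j) = h binom(h-1,j-1) bounds |binom(h,j)| by p^v(j) |h|, where
    v(j) <= floor(log_p n).  Hence the n-th Mahler term moves by at most
    p^floor(log_p n) |A_n| |h|, the weight of A_n times |h|
    ([padic_abs_binB_le]).  For n = p^k only the summand j = p^k can reach this
    bound, as v(j) < k when j < p^k, and it does because binom(h-1,p^k-1) is a
    unit as soon as p^k divides h;
    so the increment has absolute value exactly p^k |h|
    ([padic_abs_binB_scaling]).  All other weights are strictly below p^k, so by
    the isosceles principle this single term decides |T x - T y|
    ([mahler_bernoulli_locally_scaling]).

    _Conjugacy_.  This part only uses that T is (p^-k, p^k) locally scaling.
    Send x to its itinerary, the p-adic integer whose base p^k digits are the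
    residues mod p^k of x, T x, T (T x), ...  Then T becomes the deletion of one
    base p^k digit, that is the k-th iterate of the shift ([itinerary_shift]).
    Scaling says that x and y agree mod p^(k(n+1)) iff they agree mod p^k and
    T x, T y agree mod p^(kn); by induction the itineraries agree mod p^(kn) iff
    the points do ([itinerary_level_iso]).  So the itinerary map induces an
    injection, hence a permutation, of each finite ring Z/p^(kn), and a map with
    this property is a homeomorphism of the inverse limit
    ([level_iso_homeo]). *)

Set Implicit Arguments.
Unset Strict Implicit.
Unset Printing Implicit Defensive.

Import Order.TTheory GRing.Theory Num.Theory.

Local Open Scope ring_scope.

(** * The absolute value on Z_p and the shift *)

Section PadicAbsoluteValue.
Variables (p : nat) (pr : prime p).
Local Notation Zp := (padic_int pr).
Implicit Types x y u : Zp.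

Lemma residue_pXM x m n :
  residue (p%:R ^+ m * x) (m + n) = (p ^ m * residue x n)%N.
Proof.
rewrite -natrX residueM residue_nat modnMml expnD -muln_modr.
by rewrite residue_mod ?leq_addl.
Qed.

Lemma residue_shift x m n :
  residue (iter m (@padic_shift p pr) x) n = (residue x (m + n) %/ p ^ m)%N.
Proof.
have shift1 y i : residue (padic_shift y) i = (residue y i.+1 %/ p)%N.
  rewrite -residue_small; rewrite /padic_shift /=.
  have -> : (\sum_(j < i) digit y j.+1 * p ^ j = residue y i.+1 %/ p)%N.
    elim: i => [|i IHi].
      by rewrite big_ord0 divn_small// -[X in (_ < X)%N]expn1 residue_lt.
    rewrite big_ord_recr /= IHi /digit -(residue_coh y i.+1).
    rewrite [in RHS](divn_eq (residue y i.+2) (p ^ i.+1)).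
    rewrite [(p ^ i.+1)%N in RHS]expnSr.
    by rewrite mulnA divnMDl ?prime_gt0// addnC expnSr.
  rewrite modn_mod modn_small// ltn_divLR ?prime_gt0//.
  by rewrite -expnSr residue_lt.
elim: m n => [|m IHm] n; first by rewrite divn1.
by rewrite iterS shift1 IHm addnS -divnMA expnSr.
Qed.

(** Deleting the last m digits is division by p^m with remainder; it supplies
    the quotient wherever an element of p^m Z_p has to be divided by p^m. *)
Lemma padic_shift_decomp x m :
  x = (residue x m)%:R + p%:R ^+ m * iter m (@padic_shift p pr) x.
Proof.
apply: padic_eqP => n; rewrite -(residue_mod x (leq_addl m n)).
rewrite -[in RHS](residue_mod _ (leq_addl m n)); congr (_ %% _)%N.
rewrite residueD residue_pXM residue_shift residue_nat modnDml mulnC.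
rewrite -(residue_mod x (leq_addr n m)).
by rewrite [(_ %% p ^ m + _)%N]addnC -divn_eq residue_small.
Qed.

Lemma padic_abs_le1 x : padic_abs x <= 1.
Proof. by have := padic_abs_le x 0; rewrite expr0 invr1 residue0n. Qed.

Lemma padic_abs_unitP x : reflect (padic_abs x = 1) (residue x 1 != 0%N).
Proof.
apply: (iffP idP) => [x1|x1]; last first.
  by rewrite -padic_abs_le x1 -ltNge expr1 invf_lt1 ?p_gt1// ltr0n prime_gt0.
have [x0|[[|n] xn]] := padic_abs_val x; first by rewrite x0 residue0 in x1.
  by rewrite xn expr0 invr1.
case/eqP: x1; apply: (@residue_eq0_le p pr x 1 n.+1) => //.
by apply/eqP; rewrite -padic_abs_le xn.
Qed.

Lemma padic_abs_pXM_unit u n : padic_abs u = 1 ->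
  padic_abs (p%:R ^+ n * u) = p%:R ^- n.
Proof.
move/padic_abs_unitP => u1; apply/le_anti/andP; split.
  by rewrite padic_abs_le -[X in residue _ X]addn0 residue_pXM residue0n muln0.
rewrite leNgt; apply/negP => lt_un.
have [z|[m xm]] := padic_abs_val (p%:R ^+ n * u).
  have := residue_pXM u n 1; rewrite z residue0 => /esym/eqP.
  by rewrite muln_eq0 (negPf u1) expn_eq0 eqn0Ngt prime_gt0.
have : padic_abs (p%:R ^+ n * u) <= p%:R ^- (n + 1).
  rewrite xm in lt_un *.
  have q0 i : (p%:R ^+ i : rat) \is Num.pos.
    by rewrite posrE exprn_gt0// ltr0n prime_gt0.
  rewrite ltf_pV2 ?q0// ltr_eXn2l ?p_gt1// in lt_un.
  by rewrite lef_pV2 ?q0// ler_eXn2l ?p_gt1// addn1.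
rewrite padic_abs_le residue_pXM muln_eq0 (negPf u1) expn_eq0.
by rewrite eqn0Ngt prime_gt0.
Qed.

(** Reduces multiplicativity of the absolute value to units. *)
Lemma padic_abs_polar x : x = 0 \/
  exists n u, padic_abs u = 1 /\ x = p%:R ^+ n * u.
Proof.
have [->|[n xn]] := padic_abs_val x; [by left | right].
exists n, (iter n (@padic_shift p pr) x).
have xE : x = p%:R ^+ n * iter n (@padic_shift p pr) x.
  rewrite [LHS](padic_shift_decomp x n).
  have /eqP -> : residue x n == 0%N by rewrite -padic_abs_le xn.
  by rewrite add0r.
split=> //; apply/padic_abs_unitP; apply/negP => /eqP s0.
have : padic_abs x <= p%:R ^- (n + 1).
  by rewrite padic_abs_le xE residue_pXM s0 muln0.
rewrite xn leNgt ltf_pV2 ?posrE ?exprn_gt0 ?ltr0n ?prime_gt0//.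
by rewrite ltr_eXn2l ?p_gt1// addn1 leqnn.
Qed.

Lemma padic_absM x y : padic_abs (x * y) = padic_abs x * padic_abs y.
Proof.
have [->|[n [u [u1 ->]]]] := padic_abs_polar x.
  by rewrite mul0r padic_abs0 mul0r.
have [->|[m [v [v1 ->]]]] := padic_abs_polar y.
  by rewrite mulr0 padic_abs0 mulr0.
rewrite mulrACA -exprD !padic_abs_pXM_unit// ?exprD ?invfM//.
apply/padic_abs_unitP.
move/padic_abs_unitP: u1; move/padic_abs_unitP: v1 => v1 u1.
rewrite residueM expn1 -/(dvdn p _) Euclid_dvdM//.
have lt (w : Zp) : (residue w 1 < p)%N by have := residue_lt w 1; rewrite expn1.
by rewrite !gtnNdvd// lt0n.
Qed.

Lemma padic_abs_nat n : (0 < n)%N -> padic_abs (n%:R : Zp) = p%:R ^- logn p n.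
Proof.
move=> n0; have [q cpq nE] := pfactor_coprime pr n0.
rewrite {1}nE natrM natrX mulrC padic_abs_pXM_unit//.
apply/padic_abs_unitP; rewrite residue_nat expn1 -/(dvdn p q).
by rewrite -prime_coprime.
Qed.

Lemma padic_abs_isosceles x y : padic_abs x < padic_abs y ->
  padic_abs (x + y) = padic_abs y.
Proof.
move=> xy; apply/le_anti/andP; split.
  by apply: le_trans (padic_abs_ultra _ _) _; rewrite ge_max (ltW xy) lexx.
have := padic_abs_ultra (x + y) (- x).
rewrite addrAC subrr add0r padic_absN le_max => /orP[//|yx].
by have := lt_le_trans xy yx; rewrite ltxx.
Qed.

Lemma padic_abs_sum_lt (I : Type) (r : seq I) (P : pred I) (F : I -> Zp) b :
  0 < b -> (forall i, P i -> padic_abs (F i) < b) ->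
  padic_abs (\sum_(i <- r | P i) F i) < b.
Proof.
move=> b0 Fb; apply: (big_ind (fun x => padic_abs x < b)) => //.
  by rewrite padic_abs0.
move=> x y xb yb; apply: le_lt_trans (padic_abs_ultra _ _) _.
by rewrite gt_max xb.
Qed.

Lemma padic_abs_sum_le (I : Type) (r : seq I) (P : pred I) (F : I -> Zp) b :
  0 <= b -> (forall i, P i -> padic_abs (F i) <= b) ->
  padic_abs (\sum_(i <- r | P i) F i) <= b.
Proof.
move=> b0 Fb; apply: (big_ind (fun x => padic_abs x <= b)) => //.
  by rewrite padic_abs0.
move=> x y xb yb; apply: le_trans (padic_abs_ultra _ _) _.
by rewrite ge_max xb.
Qed.

Lemma padic_abs_gt0 x : x != 0 -> 0 < padic_abs x.
Proof.
move=> x0; rewrite lt_def padic_abs_ge0 andbT.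
by apply: contraNneq x0 => /padic_abs_eq0 ->.
Qed.

End PadicAbsoluteValue.

(** * Increments of binomial functions *)

Section Binomials.
Variables (p : nat) (pr : prime p).
Local Notation Zp := (padic_int pr).
Implicit Types x y h : Zp.

Lemma padic_bin0 x : padic_bin x 0 = 1.
Proof. by have := padic_binP x 0; rewrite big_ord0 fact0 mul1r. Qed.

(** Both sides are the product of the first j + 1 factors of the falling
    factorial, up to the cancellable factor j!. *)
Lemma padic_bin_absorb h j :
  j.+1%:R * padic_bin h j.+1 = h * padic_bin (h - 1) j.
Proof.
apply: (@padic_natM_inj p pr j`!); first exact: fact_gt0.
rewrite mulrA -natrM mulnC -factS padic_binP big_ord_recl subr0 mulrCA.
rewrite padic_binP.
congr (_ * _); apply: eq_bigr => i _.
by rewrite -addrA -opprD -natr1 [1 + _]addrC.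
Qed.

Lemma padic_bin_nat a k : padic_bin (a%:R : Zp) k = 'C(a, k)%:R.
Proof.
by apply/esym/padic_bin_uniq; rewrite padic_ffactE -natrM mulnC bin_ffact.
Qed.

(** Continuity of binom(-, k), with the loss of precision caused by the
    division by k!.  It transfers polynomial identities from the dense subset of
    natural numbers to Z_p. *)
Lemma residue_padic_bin_eq x y k n N : (logn p k`! + n <= N)%N ->
  residue x N = residue y N ->
  residue (padic_bin x k) n = residue (padic_bin y k) n.
Proof.
move=> leN xy.
rewrite -(padic_bin_uniq (padic_bin_exists x k)).
rewrite -(padic_bin_uniq (padic_bin_exists y k)) /=.
by rewrite -(residue_mod x leN) xy residue_mod.
Qed.

Lemma padic_bin_Vandermonde x h n :
  padic_bin (x + h) n = \sum_(j < n.+1) padic_bin h j * padic_bin x (n - j).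
Proof.
apply: padic_eqP => m; set N := (logn p n`! + m)%N.
have approx y : residue y N = residue ((residue y N)%:R : Zp) N.
  by rewrite residue_nat residue_small.
have bin_approx y j : (j <= n)%N -> residue (padic_bin y j) m =
    residue (padic_bin ((residue y N)%:R : Zp) j) m.
  move=> jn; apply: residue_padic_bin_eq (approx y).
  rewrite leq_add2r dvdn_leq_log ?fact_gt0//.
  by rewrite -(bin_fact jn) mulnCA dvdn_mulr.
transitivity (residue (padic_bin ((residue h N + residue x N)%:R : Zp) n) m).
  apply: (@residue_padic_bin_eq _ _ _ _ N) => //.
  by rewrite residueD residue_nat addnC.
(* Every argument is now a natural number, where the identity is known. *)
rewrite padic_bin_nat -binomial.Vandermonde natr_sum.
apply: (big_ind2 (fun u v : Zp => residue u m = residue v m)) => //.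
  by move=> u u' v v' uu' vv'; rewrite !residueD uu' vv'.
move=> j _; rewrite natrM -!padic_bin_nat !residueM.
have jn : (j <= n)%N by rewrite -ltnS.
by rewrite -(bin_approx h j jn) -(bin_approx x (n - j)%N (leq_subr j n)).
Qed.

Lemma padic_bin_Pascal h i :
  padic_bin h i.+1 = padic_bin (h - 1) i + padic_bin (h - 1) i.+1.
Proof.
rewrite -{1}[h](subrK 1) (padic_bin_Vandermonde (h - 1) 1).
rewrite 2!big_ord_recl big1 => [|j _].
  by rewrite addr0 !(padic_bin_nat 1) !mul1r subn0 subn1 addrC.
by rewrite (padic_bin_nat 1) bin_small ?mul0r.
Qed.

(** Taking absolute values in the absorption identity. *)
Lemma padic_abs_bin h j :
  padic_abs (padic_bin h j.+1) =
  p%:R ^+ logn p j.+1 * padic_abs h * padic_abs (padic_bin (h - 1) j).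
Proof.
have := congr1 (@padic_abs p pr) (padic_bin_absorb h j).
rewrite !padic_absM padic_abs_nat// -mulrA => <-; rewrite mulVKf//.
by rewrite expf_neq0// pnatr_eq0 -lt0n prime_gt0.
Qed.

Lemma padic_abs_bin_le h j :
  padic_abs (padic_bin h j.+1) <= p%:R ^+ logn p j.+1 * padic_abs h.
Proof.
by rewrite padic_abs_bin ler_piMr ?padic_abs_le1// mulr_ge0 ?padic_abs_ge0.
Qed.

Lemma logn_lt_expn j k : (0 < j < p ^ k)%N -> (logn p j < k)%N.
Proof.
move=> /andP[j0 jk]; rewrite -(@ltn_exp2l p) ?prime_gt1//.
by apply: leq_ltn_trans jk; rewrite dvdn_leq// pfactor_dvdnn.
Qed.

Lemma padic_binB x h n : padic_bin (x + h) n.+1 - padic_bin x n.+1 =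
  \sum_(j < n.+1) padic_bin h j.+1 * padic_bin x (n - j).
Proof.
rewrite padic_bin_Vandermonde big_ord_recl padic_bin0 mul1r subn0.
by rewrite addrAC subrr add0r.
Qed.

Lemma padic_abs_binB_le x h n :
  padic_abs (padic_bin (x + h) n - padic_bin x n) <=
  p%:R ^+ trunc_log p n * padic_abs h.
Proof.
case: n => [|n].
  by rewrite !padic_bin0 subrr padic_abs0 mulr_ge0 ?padic_abs_ge0.
rewrite padic_binB; apply: padic_abs_sum_le => [|j _].
  by rewrite mulr_ge0 ?padic_abs_ge0.
rewrite padic_absM; apply: (@le_trans _ _ (padic_abs (padic_bin h j.+1))).
  by rewrite ler_piMr ?padic_abs_le1 ?padic_abs_ge0.
apply: le_trans (padic_abs_bin_le h j) _.
rewrite ler_wpM2r ?padic_abs_ge0// ler_eXn2l ?p_gt1//.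
rewrite trunc_log_max ?prime_gt1//.
by apply: leq_trans (ltn_ord j); rewrite dvdn_leq// pfactor_dvdnn.
Qed.

(** By Pascal's rule two consecutive values binom(h-1,i), binom(h-1,i+1) add up
    to binom(h,i+1), which lies in p Z_p because v(i+1) < k <= v(h); so the
    property of being a unit propagates from i = 0. *)
Lemma padic_abs_bin_pred h k i : padic_abs h <= p%:R ^- k -> (i < p ^ k)%N ->
  padic_abs (padic_bin (h - 1) i) = 1.
Proof.
move=> hk; elim: i => [|i IHi] ik.
  rewrite padic_bin0; apply/padic_abs_unitP.
  by rewrite (residue_nat pr 1) expn1 modn_small ?prime_gt1.
have -> : padic_bin (h - 1) i.+1 = padic_bin h i.+1 + - padic_bin (h - 1) i.
  by rewrite (padic_bin_Pascal h) addrAC subrr add0r.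
rewrite padic_abs_isosceles padic_absN IHi// ?(ltnW ik)//.
apply: le_lt_trans (padic_abs_bin_le h i) _.
rewrite -ltr_pdivlMl ?exprn_gt0 ?ltr0n ?prime_gt0// mulr1.
apply: le_lt_trans hk _; rewrite ltf_pV2 ?posrE ?exprn_gt0 ?ltr0n ?prime_gt0//.
by rewrite ltr_eXn2l ?p_gt1// logn_lt_expn.
Qed.

(** Only the last Vandermonde summand, j = p^k, attains the general bound, so
    it gives the absolute value of the whole sum. *)
Lemma padic_abs_binB_scaling x h k : padic_abs h <= p%:R ^- k ->
  padic_abs (padic_bin (x + h) (p ^ k) - padic_bin x (p ^ k)) =
  p%:R ^+ k * padic_abs h.
Proof.
move=> hk; have [->|h0] := eqVneq h 0.
  by rewrite addr0 subrr padic_abs0 mulr0.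
have q_gt0 := pX_gt0 pr k.
rewrite -(prednK q_gt0) padic_binB big_ord_recr /= subnn.
have top : padic_abs (padic_bin h (p ^ k).-1.+1 * padic_bin x 0) =
    p%:R ^+ k * padic_abs h.
  rewrite padic_bin0 mulr1 padic_abs_bin (padic_abs_bin_pred hk) ?prednK//.
  by rewrite pfactorK// mulr1.
rewrite padic_abs_isosceles top//; apply: padic_abs_sum_lt => [|j _].
  by rewrite mulr_gt0 ?padic_abs_gt0// exprn_gt0// ltr0n prime_gt0.
rewrite padic_absM; apply: (@le_lt_trans _ _ (padic_abs (padic_bin h j.+1))).
  by rewrite ler_piMr ?padic_abs_le1 ?padic_abs_ge0.
apply: le_lt_trans (padic_abs_bin_le h j) _.
rewrite ltr_pM2r ?padic_abs_gt0// ltr_eXn2l ?p_gt1// logn_lt_expn//=.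
by rewrite -[X in (_ < X)%N](prednK q_gt0) ltnS ltn_ord.
Qed.

End Binomials.

(** * Mahler-Bernoulli maps are locally scaling *)

Section MahlerSeries.
Variables (p : nat) (pr : prime p).
Local Notation Zp := (padic_int pr).
Implicit Types (x y : Zp) (A : nat -> Zp) (T : Zp -> Zp).

Lemma mahler_series_approx A T x e : mahler_series A T -> 0 < e ->
  \forall N \near \oo%classic,
    padic_abs (T x - \sum_(n < N) A n * padic_bin x n) < e.
Proof.
move=> AT e0.
have := entourage_ball Zp (PosNum e0); set E := (X in entourage X) => entE.
have nbhsE : nbhs (T : {uniform Zp -> Zp}%classic)
    [set h | forall y, setT y -> E (T y, h y)]%classic.
  by apply/uniform_nbhs; exists E; split.
have := AT _ nbhsE; rewrite /nbhs /=; apply: filterS => N /(_ x I).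
by rewrite /E /= ballEmdist.
Qed.

(** The terms other than n = p^k contribute strictly less than p^k |x - y|, so
    that term alone decides. *)
Lemma mahler_bernoulli_sum_scaling A k N x y :
  (forall n, (1 <= n)%N -> n != (p ^ k)%N -> mahler_weight A n < p%:R ^+ k) ->
  padic_abs (A (p ^ k)%N) = 1 -> (p ^ k < N)%N ->
  x != y -> padic_abs (x - y) <= p%:R ^- k ->
  padic_abs (\sum_(n < N) A n * padic_bin x n -
             \sum_(n < N) A n * padic_bin y n) =
  p%:R ^+ k * padic_abs (x - y).
Proof.
move=> wA A1 kN xy hk.
have h_gt0 : 0 < padic_abs (x - y) by rewrite padic_abs_gt0// subr_eq0.
have xE : x = y + (x - y) by rewrite addrC subrK.
rewrite -sumrB (bigD1 (Ordinal kN))//= addrC -mulrBr.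
have main :
  padic_abs (A (p ^ k)%N * (padic_bin x (p ^ k) - padic_bin y (p ^ k))) =
  p%:R ^+ k * padic_abs (x - y).
  by rewrite padic_absM A1 mul1r {1}xE padic_abs_binB_scaling.
rewrite -main; apply: padic_abs_isosceles; rewrite main.
apply: padic_abs_sum_lt => [|n].
  by rewrite mulr_gt0// exprn_gt0// ltr0n prime_gt0.
rewrite -val_eqE /= -mulrBr => nk; case: n nk => -[|n] nN /= nk.
  rewrite !padic_bin0 subrr mulr0 padic_abs0.
  by rewrite mulr_gt0// exprn_gt0// ltr0n prime_gt0.
rewrite padic_absM {1}xE.
apply: le_lt_trans (ler_wpM2l (padic_abs_ge0 _) (padic_abs_binB_le _ _ _)) _.
by rewrite mulrA [padic_abs _ * _]mulrC ltr_pM2r//; exact: wA.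
Qed.

Lemma mahler_bernoulli_locally_scaling T k :
  mahler_bernoulli T (p%:R ^+ k) -> locally_scaling (p%:R ^- k) (p%:R ^+ k) T.
Proof.
move=> [A [AT leA [n0 [n0_ge1 An0 n0_uniq [j j0 n0E] An0_1]]]].
(* The weight of the dominant coefficient is p^j, so its index is p^k. *)
have jk : j = k.
  move: An0; rewrite /mahler_weight An0_1 mulr1 n0E trunc_expnK ?prime_gt1//.
  by apply/ieexprIn; rewrite ?ltr0n ?prime_gt0// pnatr_eq1 gtn_eqF ?prime_gt1.
subst n0 j.
split; [exists (- k%:Z); first by rewrite oppr_le0 | by exists k |].
  by rewrite exprnN.
move=> x y hk; have [->|xy] := eqVneq x y.
  by rewrite !subrr padic_abs0 mulr0.
have wA n : (1 <= n)%N -> n != (p ^ k)%N -> mahler_weight A n < p%:R ^+ k.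
  move=> n1 nk; rewrite lt_neqAle leA// andbT.
  by apply: contraNneq nk => /n0_uniq ->.
have e0 : 0 < p%:R ^+ k * padic_abs (x - y) :> rat.
  by rewrite mulr_gt0 ?padic_abs_gt0 ?subr_eq0// exprn_gt0// ltr0n prime_gt0.
(* Far partial sums approximate T x and T y more closely than p^k |x - y|, so
   replacing T by such a partial sum does not change |T x - T y|. *)
near \oo%classic => N.
have kN : (p ^ k < N)%N by near: N; exists (p ^ k).+1.
have Tx : padic_abs (T x - \sum_(n < N) A n * padic_bin x n)
    < p%:R ^+ k * padic_abs (x - y).
  by near: N; exact: mahler_series_approx.
have Ty : padic_abs (T y - \sum_(n < N) A n * padic_bin y n)
    < p%:R ^+ k * padic_abs (x - y).
  by near: N; exact: mahler_series_approx.
have S := mahler_bernoulli_sum_scaling wA An0_1 kN xy hk.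
rewrite -S; set sx := \sum_(n < N) _ in S Tx *.
set sy := \sum_(n < N) _ in S Ty *.
have -> : T x - T y = (T x - sx) - (T y - sy) + (sx - sy).
  by rewrite opprB addrAC !subrKA.
apply: padic_abs_isosceles; rewrite S.
apply: le_lt_trans (padic_abs_ultra _ _) _.
by rewrite gt_max Tx padic_absN.
Unshelve. all: by end_near. Qed.

End MahlerSeries.

(** * Locally scaling maps are conjugate to a power of the shift *)

Section Coding.
Variables (p : nat) (pr : prime p) (k : nat).
Local Notation Zp := (padic_int pr).
Implicit Types (x y z : Zp) (T F G : Zp -> Zp).

Definition itinerary_sum T n x :=
  (\sum_(i < n) residue (iter i T x) k * p ^ (k * i))%N.

Lemma itinerary_sumS T n x :
  itinerary_sum T n.+1 x = (residue x k + p ^ k * itinerary_sum T n (T x))%N.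
Proof.
rewrite /itinerary_sum big_ord_recl muln0 muln1 big_distrr /=; congr (_ + _)%N.
apply: eq_bigr => i _.
by rewrite -iterS iterSr mulnCA -expnD -mulnS.
Qed.

Hypothesis k_gt0 : (0 < k)%N.

Fact itinerary_coh T x n :
  itinerary_sum T n.+1 x = itinerary_sum T n x %[mod p ^ n].
Proof.
rewrite /itinerary_sum big_ord_recr /= addnC -modnDml.
suff /eqP -> : (p ^ n %| residue (iter n T x) k * p ^ (k * n))%N by [].
by rewrite dvdn_mull// dvdn_exp2l// leq_pmull.
Qed.

Definition itinerary T x : Zp := padic_of pr (itinerary_coh T x).

(** The first base p^k digit of the itinerary of x is x mod p^k, and the
    remaining ones form the itinerary of T x. *)
Lemma itineraryE T x :
  itinerary T x = (residue x k)%:R + p%:R ^+ k * itinerary T (T x).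
Proof.
apply: padic_eqP => n; rewrite residueD residue_nat residueM -natrX residue_nat.
by rewrite /= modnMm modnDm -itinerary_sumS itinerary_coh.
Qed.

Lemma iter_shift_digit c z : (c < p ^ k)%N ->
  iter k (@padic_shift p pr) (c%:R + p%:R ^+ k * z) = z.
Proof.
move=> c_lt; apply: padic_eqP => n; rewrite residue_shift.
rewrite residueD residue_pXM residue_nat modnDml.
have zn := residue_lt z n; have pk := pX_gt0 pr k.
rewrite modn_small; first by rewrite addnC mulnC divnMDl// divn_small// addn0.
apply: (@leq_trans (p ^ k * (residue z n).+1)).
  by rewrite mulnS ltn_add2r.
by rewrite expnD leq_pmul2l.
Qed.

Lemma itinerary_shift T x :
  itinerary T (T x) = iter k (@padic_shift p pr) (itinerary T x).
Proof. by rewrite [itinerary T x]itineraryE iter_shift_digit ?residue_lt. Qed.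

(** Such an F induces an injective, hence bijective, self-map of Z/p^(kn) for
    every n. *)
Definition level_iso F := forall n x y,
  residue (F x) (k * n) = residue (F y) (k * n) <->
  residue x (k * n) = residue y (k * n).

Lemma residue_multiples_inj x y :
  (forall n, residue x (k * n) = residue y (k * n)) -> x = y.
Proof.
move=> xy; apply: padic_eqP => n.
by rewrite -(residue_mod x (leq_pmull n k_gt0)) xy residue_mod ?leq_pmull.
Qed.

(** The scaling property read on digits: on a ball of radius p^-k, closeness
    p^-(k(n+1)) of x and y is closeness p^-(kn) of their images. *)
Lemma locally_scaling_residue T : locally_scaling (p%:R ^- k) (p%:R ^+ k) T ->
  forall x y n, residue x (k * n.+1) = residue y (k * n.+1) <->
    residue x k = residue y k /\ residue (T x) (k * n) = residue (T y) (k * n).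
Proof.
move=> [_ _ scT] x y n.
have eqE (u v : Zp) m :
    residue u m = residue v m <-> padic_abs (u - v) <= p%:R ^- m.
  by rewrite padic_abs_le residueB_eq0; split=> /eqP.
have kk : (k <= k * n.+1)%N by rewrite leq_pmulr.
suff H : padic_abs (x - y) <= p%:R ^- k ->
    (padic_abs (x - y) <= p%:R ^- (k * n.+1)) =
    (padic_abs (T x - T y) <= p%:R ^- (k * n)).
  split=> [xy|[xy TT]].
    have xyk : residue x k = residue y k.
      by rewrite -(residue_mod x kk) xy residue_mod.
    by split=> //; apply/eqE; rewrite -H; apply/eqE.
  by apply/eqE; rewrite H; apply/eqE.
move=> xyk; rewrite scT// mulnS exprD invfM.
by rewrite ler_pdivlMl// exprn_gt0// ltr0n prime_gt0.
Qed.

Lemma itinerary_level_iso T : locally_scaling (p%:R ^- k) (p%:R ^+ k) T ->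
  level_iso (itinerary T).
Proof.
move=> scT; elim=> [|n IHn] x y; first by rewrite muln0 !residue0n.
have itS z : residue (itinerary T z) (k * n.+1) =
    (residue (itinerary T (T z)) (k * n) * p ^ k + residue z k)%N.
  rewrite {1}itineraryE mulnS residueD residue_pXM residue_nat modnDml.
  rewrite addnC mulnC modn_small//.
  apply: (@leq_trans ((residue (itinerary T (T z)) (k * n)).+1 * p ^ k)).
    by rewrite mulSnr ltn_add2l residue_lt.
  by rewrite expnD mulnC leq_pmul2l ?pX_gt0// residue_lt.
apply: iff_trans (iff_sym (locally_scaling_residue scT x y n)).
rewrite !itS; split=> [E|[-> /IHn ->]//]; split.
  by have := congr1 (modn^~ (p ^ k)%N) E; rewrite !modnMDl !residue_small.
apply/IHn; have := congr1 (divn^~ (p ^ k)%N) E.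
by rewrite !divnMDl ?pX_gt0// !divn_small ?residue_lt// !addn0.
Qed.

Lemma level_iso_continuous F : level_iso F -> continuous F.
Proof.
move=> isoF x A /nbhs_ballP[e /= e0 ballA].
have [N Ne] : exists N, p%:R ^- N < e.
  exists (Num.truncn e^-1).+1; rewrite -ltf_pV2 ?posrE// ?pV_gt0// invrK.
  apply: lt_trans (truncnS_gt _) _; rewrite -natrX ltr_nat.
  by rewrite ltn_expl// prime_gt1.
apply/nbhs_ballP; exists (p%:R ^- (k * N)) => [|y /= xy]; first exact: pV_gt0.
apply: ballA; move: xy; rewrite !ballEmdist /= => /ltW.
rewrite ![mdist _ _]/(padic_abs _).
rewrite padic_abs_le residueB_eq0 => /eqP/isoF xy; apply: le_lt_trans Ne.
rewrite padic_abs_le residueB_eq0 -!(residue_mod _ (leq_pmull N k_gt0)).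
by rewrite xy.
Qed.

(** Bijectivity on Z/p^(kn) provides approximate preimages a_n at every level;
    injectivity forces them to be compatible, so they define a point of the
    inverse limit. *)
Lemma level_iso_surjective F : level_iso F -> forall y, exists x, F x = y.
Proof.
move=> isoF y.
have ex n : exists a : 'I_(p ^ (k * n)),
    residue (F a%:R) (k * n) == residue y (k * n).
  (* The map induced by F on Z/p^(kn). *)
  pose f (a : 'I_(p ^ (k * n))) := Ordinal (residue_lt (F a%:R) (k * n)).
  have f_inj : injective f.
    move=> a b /(congr1 val) /= /isoF.
    by rewrite !residue_nat !modn_small// => /val_inj.
  have [g _ gK] := injF_bij f_inj.
  exists (g (Ordinal (residue_lt y (k * n)))).
  by have /(congr1 val) /= -> := gK (Ordinal (residue_lt y (k * n))).
pose a n : nat := xchoose (ex n).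
have aP n : residue (F (a n)%:R) (k * n) = residue y (k * n).
  exact/eqP/(xchooseP (ex n)).
have le_kS n : (k * n <= k * n.+1)%N by rewrite leq_mul2l leqnSn orbT.
have a_step n : a n.+1 = a n %[mod p ^ (k * n)].
  have /isoF : residue (F (a n.+1)%:R) (k * n) = residue (F (a n)%:R) (k * n).
    by rewrite -(residue_mod _ (le_kS n)) aP residue_mod.
  by rewrite !residue_nat.
have a_mod m n i : (m <= n)%N -> (i <= k * m)%N -> a n = a m %[mod p ^ i].
  move=> mn im; elim: n mn => [|n IHn]; first by rewrite leqn0 => /eqP ->.
  rewrite leq_eqVlt => /predU1P[->//|mn]; rewrite -(IHn mn).
  have d : (p ^ i %| p ^ (k * n))%N.
    by rewrite dvdn_exp2l// (leq_trans im)// leq_mul2l (mn : (m <= n)%N) orbT.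
  by rewrite -(modn_dvdm _ d) a_step modn_dvdm.
have a_coh n : a n.+1 = a n %[mod p ^ n] by apply: a_mod; rewrite ?leq_pmull.
exists (padic_of pr a_coh); apply: residue_multiples_inj => n; rewrite -aP.
apply/isoF; rewrite residue_nat /=.
by apply: a_mod; rewrite // leq_pmull.
Qed.

Lemma level_iso_homeo F : level_iso F ->
  exists G, [/\ cancel F G, cancel G F, continuous F & continuous G].
Proof.
move=> isoF; have F_inj : injective F.
  by move=> x y xy; apply: residue_multiples_inj => n; apply/isoF; rewrite xy.
have [G GK] := choice (level_iso_surjective isoF).
exists G; split=> //; [|exact: level_iso_continuous|].
  by move=> x; apply: F_inj; rewrite GK.
apply: level_iso_continuous => n x y.
by rewrite -{2}[x]GK -{2}[y]GK; apply: iff_sym; exact: isoF.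
Qed.

Lemma locally_scaling_shift T : locally_scaling (p%:R ^- k) (p%:R ^+ k) T ->
  topologically_isomorphic T (iter k (@padic_shift p pr)).
Proof.
move=> /itinerary_level_iso/level_iso_homeo[G [FK GK Fc Gc]].
by exists (itinerary T), G; split=> // x; exact: itinerary_shift.
Qed.

End Coding.

Theorem theorem4p13 (p : nat) (pr : prime p) (T : padic_int pr -> padic_int pr)
    (k : nat) (k_ge1 : (1 <= k)%N) (hT : mahler_bernoulli T (p%:R ^+ k)) :
  locally_scaling (p%:R ^- k) (p%:R ^+ k) T /\
  topologically_isomorphic T (iter k (@padic_shift p pr)).
Proof.
have scT := mahler_bernoulli_locally_scaling hT.
by split=> //; exact: locally_scaling_shift.
Qed.
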